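(* For any countable infinite group $\Gamma$, each of the groups (1) $\mathbb{Z}_p^{<\omega}\times\Gamma^\omega$, for any prime $p$; (2) $(\bigoplus_{p\text{ prime}}\mathbb{Z}_p)\times\Gamma^\omega$; and (3) $\mathbb{Z}\times\Gamma^\omega$ has a continuous action on a Polish space whose orbit equivalence relation is not potentially $\mathbf{\Pi}^0_3$.
   Context: $\mathbb{Z}_p^{<\omega}=\bigoplus_{n<\omega}\mathbb{Z}_p$. Countable groups carry the discrete topology and countable products the product topology. An equivalence relation $E$ on a Polish space $X$ is potentially $\mathbf{\Pi}^0_3$ if there is a Polish topology on $X$ with the same Borel sets in which $E$ is $\mathbf{\Pi}^0_3$ in $X\times X$. *)

(* Defs.v *)
From HB Require Import structures.
From mathcomp Require Import all_boot all_order all_algebra.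
From mathcomp Require Import all_classical all_reals all_analysis.
From mathcomp Require Import borel_hierarchy.

Set Implicit Arguments.
Unset Strict Implicit.
Unset Printing Implicit Defensive.

Local Open Scope classical_set_scope.

#[short(type="preTopologicalGroupType")]
HB.structure Definition PreTopologicalGroup :=
  {G of Topological G & Group G}.

HB.mixin Record PreTopologicalGroup_isTopologicalGroup G
    & PreTopologicalGroup G := {
  mulg_continuous : continuous (fun xy : G * G => (xy.1 * xy.2)%g) ;
  invg_continuous : continuous (fun x : G => (x^-1)%g)
}.

#[short(type="topologicalGroupType")]
HB.structure Definition TopologicalGroup :=
  {G of PreTopologicalGroup G & PreTopologicalGroup_isTopologicalGroup G}.

Lemma cvg_mulg (T : Type) (G : topologicalGroupType) (F : set_system T)
    (f g : T -> G) (a b : G) : Filter F ->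
  f @ F --> a -> g @ F --> b -> (fun x => (f x * g x)%g) @ F --> (a * b)%g.
Proof.
move=> FF; apply: (@continuous2_cvg _ _ _ _ _ _ f g (fun x y => (x * y)%g)).
exact: (@mulg_continuous G (a, b)).
Qed.

Lemma cvg_invg (T : Type) (G : topologicalGroupType) (F : set_system T)
    (f : T -> G) (a : G) : Filter F ->
  f @ F --> a -> (fun x => (f x)^-1%g) @ F --> (a^-1)%g.
Proof. by move=> FF fa; apply: cvg_comp fa _; exact: invg_continuous. Qed.

Section DiscreteGroup.
Variable G : groupType.

HB.instance Definition _ := Group.copy (discrete_topology G) G.

Let D := discrete_topology G.

Lemma discrete_mulg_continuous :
  continuous (fun xy : D * D => (xy.1 * xy.2)%g).
Proof.
move=> [x y] A /nbhs_singleton Axy.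
exists ([set x], [set y]); first by split; exact: discrete_set1.
by move=> [u v] /= [-> ->].
Qed.

Lemma discrete_invg_continuous : continuous (fun x : D => (x^-1)%g).
Proof.
move=> x A /nbhs_singleton Ax.
apply: (@filterS _ (nbhs x) _ [set x]) (discrete_set1 _).
by move=> _ ->.
Qed.

HB.instance Definition _ := PreTopologicalGroup_isTopologicalGroup.Build
  (discrete_topology G) discrete_mulg_continuous discrete_invg_continuous.

End DiscreteGroup.

Section PairGroup.
Variables G H : topologicalGroupType.

Lemma pair_mulg_continuous :
  continuous (fun xy : (G * H) * (G * H) => (xy.1 * xy.2)%g).
Proof.
move=> xy; apply: (cvg_pair (F := nbhs xy) (f := fun z => (z.1.1 * z.2.1)%g)
    (g := fun z => (z.1.2 * z.2.2)%g)).
- apply: cvg_mulg.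
  + by apply: cvg_comp; [exact: cvg_fst | exact: cvg_fst].
  + by apply: cvg_comp; [exact: cvg_snd | exact: cvg_fst].
- apply: cvg_mulg.
  + by apply: cvg_comp; [exact: cvg_fst | exact: cvg_snd].
  + by apply: cvg_comp; [exact: cvg_snd | exact: cvg_snd].
Qed.

Lemma pair_invg_continuous : continuous (fun x : G * H => (x^-1)%g).
Proof.
move=> x; apply: (cvg_pair (F := nbhs x) (f := fun z => (z.1^-1)%g)
    (g := fun z => (z.2^-1)%g)).
- by apply: cvg_invg; exact: cvg_fst.
- by apply: cvg_invg; exact: cvg_snd.
Qed.

HB.instance Definition _ := PreTopologicalGroup_isTopologicalGroup.Build
  (G * H)%type pair_mulg_continuous pair_invg_continuous.

End PairGroup.

Definition direct_product (I : Type) (G : I -> Type) := forall i, G i.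

HB.instance Definition _ (I : Type) (G : I -> choiceType) :=
  Choice.copy (direct_product G) (forall i, G i).

Section DirectProduct.
Variables (I : Type) (G : I -> groupType).
Implicit Types f g : direct_product G.

Let mul f g : direct_product G := fun i => (f i * g i)%g.
Let inv f : direct_product G := fun i => (f i)^-1%g.
Let one : direct_product G := fun=> 1%g.

Let mulA : associative mul.
Proof. by move=> f g h; apply: functional_extensionality_dep => i; exact: mulgA. Qed.
Let mul1 : left_id one mul.
Proof. by move=> f; apply: functional_extensionality_dep => i; exact: mul1g. Qed.
Let mulr1 : right_id one mul.
Proof. by move=> f; apply: functional_extensionality_dep => i; exact: mulg1. Qed.
Let mulV : left_inverse one inv mul.
Proof. by move=> f; apply: functional_extensionality_dep => i; exact: mulVg. Qed.
Let mulrV : right_inverse one inv mul.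
Proof. by move=> f; apply: functional_extensionality_dep => i; exact: mulgV. Qed.

HB.instance Definition _ :=
  isGroup.Build (direct_product G) mulA mul1 mulr1 mulV mulrV.

End DirectProduct.

HB.instance Definition _ (I : Type) (G : I -> topologicalType) :=
  Topological.copy (direct_product G) (prod_topology G).

Section DirectProductTopology.
Variables (I : Type) (G : I -> topologicalGroupType).

Lemma direct_product_cvg (F : set_system (direct_product G))
    (f : direct_product G) : Filter F ->
  (forall i, (fun g : direct_product G => g i) @ F --> f i) -> F --> f.
Proof.
move=> FF Ff; apply/cvg_sup => i A [_ [[B oB <-]] /= Bf BA].
by apply: filterS BA _; apply: (Ff i); exact: open_nbhs_nbhs.
Qed.

Lemma direct_product_eval_continuous i :
  continuous (fun g : direct_product G => g i).
Proof.
move=> f A; have /cvg_sup/(_ i) fi : f --> f by exact: cvg_id.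
rewrite nbhsE => -[B [oB Bf] BA].
apply: (filterS (P := (fun g : direct_product G => g i) @^-1` B)).
  by move=> g /BA.
apply: fi; exists ((fun g : direct_product G => g i) @^-1` B).
by split => //; exists B.
Qed.

Lemma direct_product_mulg_continuous :
  continuous (fun xy : direct_product G * direct_product G =>
    (xy.1 * xy.2)%g).
Proof.
move=> xy; apply: direct_product_cvg => i.
apply: (cvg_mulg (F := nbhs xy) (f := fun z => z.1 i) (g := fun z => z.2 i)).
- apply: (cvg_comp fst (fun h : direct_product G => h i)); first exact: cvg_fst.
  exact: direct_product_eval_continuous.
- apply: (cvg_comp snd (fun h : direct_product G => h i)); first exact: cvg_snd.
  exact: direct_product_eval_continuous.
Qed.

Lemma direct_product_invg_continuous :
  continuous (fun x : direct_product G => (x^-1)%g).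
Proof.
move=> x; have FF : Filter (nbhs x) by exact: nbhs_filter.
apply: direct_product_cvg => i.
apply: (cvg_invg (F := nbhs x) (f := fun z => z i)).
exact: direct_product_eval_continuous.
Qed.

HB.instance Definition _ := PreTopologicalGroup_isTopologicalGroup.Build
  (direct_product G) direct_product_mulg_continuous
  direct_product_invg_continuous.

End DirectProductTopology.

Section DirectSum.
Variables (I : Type) (G : I -> groupType).

Definition finitely_supported : {pred direct_product G} :=
  fun f => `[< finite_set [set i | f i <> 1%g] >].

Definition direct_sum := {f : direct_product G | finitely_supported f}.

HB.instance Definition _ := SubChoice.on direct_sum.

Lemma finitely_supported_group_closed : group_closed finitely_supported.
Proof.
split=> [|f g].
  apply/asboolP; rewrite [X in finite_set X](_ : _ = set0)//.
  by apply/seteqP; split=> i //=.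
rewrite !unfold_in => /asboolP ff /asboolP fg; apply/asboolP.
apply: sub_finite_set (_ : finite_set ([set i | f i <> 1%g] `|`
  [set i | g i <> 1%g])); last by rewrite finite_setU.
move=> i /= fgi; have [fi1|] := pselect (f i = 1%g); last by left.
right => gi1; apply: fgi.
by rewrite /monoid.mul/= /monoid.inv/= fi1 gi1 divgg.
Qed.

HB.instance Definition _ := SubChoice_isSubGroup.Build
  (direct_product G) finitely_supported direct_sum
  finitely_supported_group_closed.

End DirectSum.

Definition separable (X : topologicalType) :=
  exists2 D : set X, countable D & dense D.

(* [m] is a metric on the carrier of [X]; the first conjunct says that it
   induces the topology of [X]. *)
Definition completely_metrizable (R : realType) (X : topologicalType) :=
  exists m : Metric.axioms_ R X, let M : metricType R := Metric.Pack m in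
    @open M = @open X /\
    (forall F : set_system M, ProperFilter F -> cauchy F ->
      exists x : M, F --> x).

Definition polish (R : realType) (X : topologicalType) :=
  separable X /\ completely_metrizable R X.

Definition Borel (X : topologicalType) : set (set X) := <<s @open X >>.
Arguments Borel : clear implicits.

(* Sigma^0_2 is F_sigma, so Pi^0_3 is F_sigma_delta. *)
Definition Pi03 (X : topologicalType) (A : set X) :=
  exists2 F : nat -> set X, (forall n, Fsigma (F n)) & A = \bigcap_n F n.

(* [t] is any topology on the carrier of [X], and [Y] is that carrier
   with the topology [t]. *)
Definition potentially_Pi03 (R : realType) (X : topologicalType)
    (E : set (X * X)) :=
  exists t : Topological.axioms_ X,
    let Y : topologicalType := Topological.Pack t in
    [/\ polish R Y, Borel Y = Borel X & Pi03 (E : set (Y * Y))].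

Definition is_action (G : groupType) (X : Type) (a : G -> X -> X) :=
  (forall x, a 1%g x = x) /\ (forall g h x, a (g * h)%g x = a g (a h x)).

Definition orbit_rel (G : groupType) (X : Type) (a : G -> X -> X) :
    set (X * X) :=
  [set xy | exists g, a g xy.1 = xy.2].

Definition continuous_action (G : topologicalGroupType) (X : topologicalType)
    (a : G -> X -> X) :=
  is_action a /\ continuous (fun gx : G * X => a gx.1 gx.2).

Definition has_non_potentially_Pi03_action (R : realType)
    (G : topologicalGroupType) :=
  exists2 X : topologicalType, polish R X &
    exists2 a : G -> X -> X, continuous_action a &
      ~ potentially_Pi03 R (orbit_rel a).

(* Main.v *)
(* Let [Delta] be a countable group with a dense homomorphism into a product of
   countable nontrivial groups [D i] over a countable infinite index set, and let
   [X] be the product over [i] of the Bernoulli shifts of [D i * Gamma].  The group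
   [H], the product of the [D i * Gamma], acts on [X], and the group
   [Delta * Gamma^omega] acts through its image in [H].

   If the orbit relation were potentially Pi^0_3, then, Borel sets having the
   Baire property, for a point [x] and some comeager [C] the orbit of [x] would
   agree on [C] with an intersection of sets [A n] that are F_sigma in the original
   topology.  Fix a generic [x].  By the Baire category theorem in [Gamma^omega],
   some open piece [{delta} * N] of the acting group maps [x] into a single closed
   piece of [A n] (relative to [C]).  For generic [x] the [Gamma]-orbit of each
   coordinate is dense in its shift, so the closure of [({delta} * N) x] contains
   [h x] for all [h] in an open subset of [H].  Hence [h x] belongs to every [A n]
   for comeagerly many [h] in [H], whereas, the shifts being free at [x], only
   meagerly many [h] have [h x] in the orbit of [x]. *)
From HB Require Import structures.
Require Import Defs.
From mathcomp Require Import all_boot all_order all_algebra.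
From mathcomp Require Import all_classical all_reals all_analysis.
From mathcomp Require Import lra.

Set Implicit Arguments.
Unset Strict Implicit.
Unset Printing Implicit Defensive.

Import Order.TTheory GRing.Theory Num.Theory.
Local Open Scope classical_set_scope.

(** * Baire category in countable products *)

(** For injective [e] only finitely many coordinates have code below [n], so these relations give
    the basic neighbourhoods in the product of the discrete [V j]. *)
Definition agree (J : Type) (V : J -> Type) (e : J -> nat) (n : nat)
  (f g : forall j, V j) := forall j, e j < n -> f j = g j.

Section Agree.
Variables (J : Type) (V : J -> Type) (e : J -> nat).
Implicit Types f g h : forall j, V j.

Lemma agree_sym n f g : agree e n f g -> agree e n g f.
Proof. by move=> fg j /fg. Qed.

Lemma agree_trans n f g h : agree e n f g -> agree e n g h -> agree e n f h.
Proof. by move=> fg gh j jn; rewrite fg// gh. Qed.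

Lemma agree_le m n f g : m <= n -> agree e n f g -> agree e m f g.
Proof. by move=> mn fg j jm; apply: fg; exact: leq_trans mn. Qed.

(** Stage [l] meets the set with code [l] by extending the part decided so far. Starting from a
    neighbourhood of [f0] allows density to be known only locally. *)
Lemma baire_product (K : Type) (c : K -> nat) (O : K -> set (forall j, V j))
    n0 f0 : injective c ->
  (forall k n f, n0 <= n -> agree e n0 f0 f ->
    exists g m, agree e n f g /\ forall h, agree e m g h -> O k h) ->
  exists2 f, agree e n0 f0 f & forall k, O k f.
Proof.
move=> cinj dO.
pose good (s : (forall j, V j) * nat) := n0 <= s.2 /\ agree e n0 f0 s.1.
pose next l (s s' : (forall j, V j) * nat) :=
  [/\ agree e s.2 s.1 s'.1, s.2 < s'.2 &
    forall k, c k = l -> forall h, agree e s'.2 s'.1 h -> O k h].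
have /choice[step stepP] (ls : nat * ((forall j, V j) * nat)) :
    exists s', good ls.2 -> next ls.1 ls.2 s'.
  case: ls => l [f n] /=.
  have [[n0n f0f]|ng] := pselect (good (f, n)); last by exists (f, n).
  have [[k ckl]|nk] := pselect (exists k, c k = l); last first.
    by exists (f, n.+1) => _; split => //= k ckl; case: nk; exists k.
  have [g [m [fg gO]]] := dO k n f n0n f0f.
  exists (g, maxn n.+1 m) => _; split; rewrite ?leq_max ?leqnn//= => k' ck'.
  have -> : k' = k by apply: cinj; rewrite ck' ckl.
  by move=> h /(agree_le (leq_maxr _ _)); exact: gO.
pose s := fix s l := if l is l'.+1 then step (l', s l') else (f0, n0).
have s_good l : good (s l).
  elim: l => //= l IH; have [sl sl2 _] := stepP (l, s l) IH.
  have [n0l fl] := IH; split; first exact: leq_trans (ltnW sl2).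
  by apply: agree_trans fl _; exact: agree_le sl.
have s_next l : next l (s l) (s l.+1) by exact: (stepP (l, s l) (s_good l)).
have s_mono l d : (s l).2 <= (s (l + d)).2 /\ agree e (s l).2 (s l).1 (s (l + d)).1.
  elim: d => [|d [IH1 IH2]]; first by rewrite addn0.
  rewrite addnS; have [a b _] := s_next (l + d); split.
    exact: leq_trans (ltnW b).
  by apply: agree_trans IH2 _; exact: agree_le a.
have s_ge l : l <= (s l).2.
  by elim: l => // l IH; have [_ b _] := s_next l; exact: leq_ltn_trans b.
(* By [s_ge] the coordinate [j] is decided at stage [(e j).+1], and later stages keep it. *)
pose f j := (s (e j).+1).1 j.
have sf l : agree e (s l).2 (s l).1 f.
  move=> j jl; rewrite /f; have [le|lt] := leqP l (e j).+1.
    by have [_ ->] := s_mono l ((e j).+1 - l); rewrite // subnKC.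
  have [_ /(_ j (s_ge _))] := s_mono (e j).+1 (l - (e j).+1).
  by rewrite subnKC 1?ltnW// => ->.
exists f; first exact: (sf 0).
by move=> k; have [_ _ /(_ k erefl)] := s_next (c k); apply; exact: sf.
Qed.

End Agree.

(** * The Cantor space of a coded index set *)

(* The code [e] and its injectivity are kept in the type so that the metric below
   can be a canonical instance. *)
Definition cantor (R : realType) (J : Type) (e : J -> nat) (_ : injective e) : Type :=
  J -> bool.

Section Cantor.
Variables (R : realType) (J : Type) (e : J -> nat) (einj : injective e).
Notation X := (@cantor R J e einj).
Implicit Types x y z : X.

HB.instance Definition _ := Choice.copy X (J -> bool).

Lemma agree_all x y : (forall n, agree e n x y) -> x = y.
Proof. by move=> xy; apply/funext => j; exact: (xy (e j).+1). Qed.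

(** The least code at which [x] and [y] differ; the default 0 is reached only for [x = y], which
    [cantor_dist] treats apart. *)
Definition splitting x y : nat :=
  if pselect (exists n, ~~ `[< agree e n.+1 x y >]) is left h then ex_minn h else 0.

Definition cantor_dist x y : R :=
  if x == y then 0%R else ((splitting x y).+1%:R^-1)%R.

Lemma agree_splitting x y n : x != y -> agree e n x y <-> n <= splitting x y.
Proof.
move=> xy; rewrite /splitting; case: pselect => [h|h]; last first.
  exfalso; move/eqP: xy; apply; apply: agree_all => -[//|k].
  by have [//|/asboolPn nag] := pselect (agree e k.+1 x y); case: h; exists k.
case: ex_minnP => m /asboolPn nm mmin; split => [ag|nle].
  by rewrite leqNgt; apply/negP => mn; apply: nm; exact: agree_le ag.
case: n nle => [//|n] nm'; have [//|/asboolPn /mmin] := pselect (agree e n.+1 x y).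
by rewrite leqNgt nm'.
Qed.

Lemma cantor_dist_le x y n : (cantor_dist x y <= n.+1%:R^-1)%R <-> agree e n x y.
Proof.
rewrite /cantor_dist; have [->|xy] := eqVneq x y; first by rewrite invr_ge0 ler0n.
by rewrite agree_splitting// lef_pV2 ?posrE// ler_nat ltnS.
Qed.

Lemma cantor_dist_lt x y n : (cantor_dist x y < n.+1%:R^-1)%R <-> agree e n.+1 x y.
Proof.
rewrite /cantor_dist; have [->|xy] := eqVneq x y; first by rewrite invr_gt0 ltr0n.
by rewrite agree_splitting// ltf_pV2 ?posrE// ltr_nat ltnS.
Qed.

Lemma cantor_distxx x : cantor_dist x x = 0%R.
Proof. by rewrite /cantor_dist eqxx. Qed.

Lemma cantor_dist_positivity x y : cantor_dist x y = 0%R -> x = y.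
Proof.
by move=> xy; apply: agree_all => n; apply/cantor_dist_le; rewrite xy invr_ge0.
Qed.

Lemma cantor_dist_sym x y : cantor_dist x y = cantor_dist y x.
Proof.
suff le a b : (cantor_dist a b <= cantor_dist b a)%R.
  by apply/eqP; rewrite eq_le !le.
rewrite {2}/cantor_dist; have [->|ba] := eqVneq b a; first by rewrite cantor_distxx.
by apply/cantor_dist_le/agree_sym/agree_splitting.
Qed.

Lemma cantor_dist_ge0 x y : (0 <= cantor_dist x y)%R.
Proof. by rewrite /cantor_dist; case: ifP => // _; rewrite invr_ge0. Qed.

(** The distance is an ultrametric: [x] and [z] agree below the smaller of the two splitting
    codes. *)
Lemma cantor_dist_triangle y x z :
  (cantor_dist x z <= cantor_dist x y + cantor_dist y z)%R.
Proof.
have [->|xy] := eqVneq x y; first by rewrite cantor_distxx add0r.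
have [->|yz] := eqVneq y z; first by rewrite cantor_distxx addr0.
have [le|/ltnW le] := leqP (splitting x y) (splitting y z).
- apply: (@le_trans _ _ (cantor_dist x y)); last by rewrite lerDl cantor_dist_ge0.
  rewrite [leRHS]/cantor_dist (negbTE xy); apply/cantor_dist_le.
  by apply: (@agree_trans _ _ _ _ _ y); exact/agree_splitting.
- apply: (@le_trans _ _ (cantor_dist y z)); last by rewrite lerDr cantor_dist_ge0.
  rewrite [leRHS]/cantor_dist (negbTE yz); apply/cantor_dist_le.
  by apply: (@agree_trans _ _ _ _ _ y); exact/agree_splitting.
Qed.

HB.instance Definition _ := isMetric.Build R X cantor_distxx
  cantor_dist_positivity cantor_dist_sym cantor_dist_triangle.

Lemma cantor_nbhsP x (A : set X) :
  nbhs x A <-> exists n, agree e n x `<=` A.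
Proof.
rewrite -(@nbhs_ballE R X); split => [[eps /= eps0]|[n nA]].
  rewrite ballEmdist => xA.
  have [n _ /(_ n (leqnn _)) nP] := near_infty_natSinv_lt (PosNum eps0).
  exists n => y /cantor_dist_le xy; apply: xA => /=.
  exact: le_lt_trans nP.
exists (n.+1%:R^-1)%R; first by rewrite /= invr_gt0.
by rewrite ballEmdist => y /= /cantor_dist_lt xy; apply: nA; exact: agree_le xy.
Qed.

Lemma cantor_openP (A : set X) :
  open A <-> forall x, A x -> exists n, agree e n x `<=` A.
Proof.
rewrite openE; split => [oA x /oA/cantor_nbhsP//|oA x /oA xA].
exact/cantor_nbhsP.
Qed.

Lemma cantor_denseP (A : set X) :
  dense A <-> forall x n, exists2 y, agree e n x y & A y.
Proof.
split => [dA x n|dA O [x Ox] /cantor_openP/(_ x Ox)[n nO]]; last first.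
  by have [y xy Ay] := dA x n; exists y; split => //; exact: nO.
have [||y [xy Ay]] := dA (agree e n x : set X); [by exists x| |by exists y].
by apply/cantor_openP => y xy; exists n => z; exact: agree_trans.
Qed.

Lemma separable_cantor : separable X.
Proof.
pose d (s : seq nat) : X := fun j => e j \in s.
exists (range d).
  exact: sub_countable (card_image_le d setT) (countableP _).
apply/cantor_denseP => x n.
exists (d [seq i <- iota 0 n | `[< exists2 j, e j = i & x j >]]); last first.
  by exists [seq i <- iota 0 n | `[< exists2 j, e j = i & x j >]].
move=> j jn; rewrite /d mem_filter mem_iota add0n leq0n jn /= andbT.
apply/idP/asboolP => [xj|[j' /einj ->//]]; by exists j.
Qed.

Lemma polish_cantor : polish R X.
Proof.
split; first exact: separable_cantor.
exists (Metric.class X); split => // F FF /cauchyP cF.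
have /choice[u uP] n : exists x : X, F (agree e n.+1 x).
  have n0 : (0 < n.+1%:R^-1 :> R)%R by rewrite invr_gt0.
  have [x xF] := cF _ n0; exists x; apply: filterS xF => y.
  by rewrite ballEmdist => /cantor_dist_lt.
(* The neighbourhood of [u (e j)] in [F] decides all codes up to [e j]; any two such neighbourhoods
   meet, so the choices are consistent. *)
exists (fun j => u (e j) j) => A /cantor_nbhsP[n nA].
apply: filterS (uP n) => y ny; apply: nA => j jn.
have [z [zj zn]] := filter_ex (filterI (uP (e j)) (uP n)).
by rewrite (zj j)// -(zn j) ?ny// ltnW.
Qed.

End Cantor.

(** * Potential complexity and the Baire property *)

(** This is the Baire property, with the comeager set given by a sequence of dense open sets so that
    countably many of them can be merged. *)
Definition almost_open (X : topologicalType) (A : set X) :=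
  exists V (O : nat -> set X), [/\ open V, forall n, open (O n) /\ dense (O n) &
    forall x, (forall n, O n x) -> A x <-> V x].

Section AlmostOpen.
Variable X : topologicalType.
Implicit Types A V : set X.

Lemma dense_boundaryC V : open V -> dense (V `|` ~` closure V).
Proof.
move=> oV W [x Wx] oW.
have [[y [Wy Vy]]|WV] := pselect (W `&` V !=set0); first by exists y; split; [|left].
exists x; split => //; right => /(_ W (open_nbhs_nbhs (conj oW Wx)))[y [Vy Wy]].
by apply: WV; exists y.
Qed.

Lemma open_almost_open V : open V -> almost_open V.
Proof.
move=> oV; exists V, (fun=> setT); split => // _; split; first exact: openT.
by move=> W W0 _; rewrite setIT.
Qed.

Lemma almost_openC A : almost_open A -> almost_open (~` A).
Proof.
move=> [V [Q [oV dO AV]]].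
(* The new first dense open set avoids the boundary of [V], where the complements of [V] and of
   [closure V] differ. *)
exists (~` closure V), (fun n => if n is n'.+1 then Q n' else V `|` ~` closure V).
have oVC : open (~` closure V) by apply: closed_openC; exact: closed_closure.
split=> [//|[|n] //|x Ox].
  by split; [exact: openU|exact: dense_boundaryC].
have {}AV := AV x (fun n => Ox n.+1); split => [nAx|nVx].
  by have [/AV|] := Ox 0.
by move/AV/subset_closure.
Qed.

Lemma almost_open_bigcup (A : nat -> set X) :
  (forall k, almost_open (A k)) -> almost_open (\bigcup_k A k).
Proof.
move=> /choice[V /choice[Q VO]].
exists (\bigcup_k V k), (fun n => if unpickle n is Some km then Q km.1 km.2 else setT).
split => [|n|x Ox].
- by apply: bigcup_open => k _; have [] := VO k.
- case: unpickle => [[k m]|] /=; first by have [_ + _] := VO k.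
  by split; [exact: openT|move=> W W0 _; rewrite setIT].
- have AV k : A k x <-> V k x.
    have [_ _] := VO k; apply => m.
    by have := Ox (pickle (k, m)); rewrite pickleK.
  by split=> -[k _ /AV]; exists k.
Qed.

Lemma Borel_almost_open A : Borel X A -> almost_open A.
Proof.
move: A; apply: smallest_sub => [|A]; last exact: open_almost_open.
split => [|A|]; [exact: open_almost_open open0| |exact: almost_open_bigcup].
by rewrite setTD; exact: almost_openC.
Qed.

End AlmostOpen.

Lemma polish_second_countable (R : realType) (Y : topologicalType) :
  polish R Y -> exists2 W : nat -> set Y, (forall n, open (W n)) &
    forall y U, open U -> U y -> exists2 n, W n y & W n `<=` U.
Proof.
move=> [[D /countable_injP[f finj] dD] [m [oM _]]].
pose M : metricType R := Metric.Pack m.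
pose r n : R := (n.+1%:R^-1)%R.
have r0 n : (0 < r n)%R by rewrite invr_gt0.
(* The centre is known only through its code, so a union over all points of [D] with that code
   stands for a single ball. *)
pose W k : set M := if unpickle k is Some an then
  \bigcup_(d in [set d | D d /\ f d = an.1]) (@ball R M d (r an.2))° else set0.
exists W => [k|y U oU Uy].
  rewrite -oM /W; case: unpickle => [[a n]|]; last exact: open0.
  by apply: bigcup_open => d _; exact: open_interior.
have : nbhs (y : M) U by apply: open_nbhs_nbhs; rewrite /open_nbhs oM.
rewrite -(@nbhs_ballE R M) => -[eps /= eps0 yU].
(* A radius below [eps / 2] leaves room for a centre within [r n / 2] of [y] and a ball of radius
   [r n] around it. *)
have [n _ /(_ n (leqnn _)) nP] :=
  near_infty_natSinv_lt (PosNum (divr_gt0 eps0 (ltr0Sn R 1))).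
have [||d [yd Dd]] := dD (@ball R M y (r n / 2)%R)°.
- by exists y; apply: nbhsx_ballx; rewrite divr_gt0.
- by rewrite -oM; exact: open_interior.
have {}yd : @ball R M y (r n / 2)%R d := interior_subset yd.
have dy : @ball R M d (r n / 2)%R y by exact: ball_sym.
exists (pickle (f d, n)); rewrite /W pickleK /=.
  exists d => //; apply: (@filterS _ (nbhs (y : M)) _ (@ball R M y (r n / 2)%R)).
    by move=> z yz; rewrite [r n]splitr; exact: ball_triangle yz.
  by apply: nbhsx_ballx; rewrite divr_gt0.
move=> z [d' [Dd' fdd'] /interior_subset dz].
have {}dz : @ball R M d (r n) z.
  by have -> : d = d' by apply: finj; rewrite ?inE.
apply: yU; apply: (@le_ball R M y (r n / 2 + r n)%R); last exact: ball_triangle dz.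
by have := r0 n; rewrite /= -/(r n) in nP *; lra.
Qed.

Lemma closed_section (Y : topologicalType) (B : set (Y * Y)) (x : Y) :
  closed B -> closed [set y | B (x, y)].
Proof.
move=> cB; apply: (@closed_comp _ _ (fun y => (x, y)) B) => // y _.
by apply: cvg_pair; [exact: cvg_cst|exact: cvg_id].
Qed.

(** A basic open set of the second topology is Borel in the first, hence agrees with an open set
    there off a meager set. There are countably many basic sets, so one comeager set serves all
    [x]. *)
Lemma potentially_Pi03_section (R : realType) (X : topologicalType) (E : set (X * X)) :
  potentially_Pi03 R E ->
  exists2 O : nat -> set X, (forall n, open (O n) /\ dense (O n)) &
    forall x, exists2 B : nat -> nat -> set X, (forall n m, closed (B n m)) &
      forall y, (forall n, O n y) -> E (x, y) <-> forall n, exists m, B n m y.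
Proof.
move=> [t]; set Y := Topological.Pack t => -[pY BE [F FF EF]].
have [W oW bW] := polish_second_countable pY.
have /choice[V /choice[Q VO]] n : @almost_open X (W n).
  by apply: Borel_almost_open; rewrite -BE; apply: sub_gen_smallest; exact: oW.
exists (fun n => if unpickle n is Some km then Q km.1 km.2 else setT) => [n|x].
  case: unpickle => [[k m]|] /=; first by have [_ + _] := VO k.
  by split; [exact: openT|move=> A A0 _; rewrite setIT].
have /choice[S S_] n : exists S : nat -> set (Y * Y),
    (forall m, closed (S m)) /\ F n = \bigcup_m S m.
  by have [S cS FS] := FF n; exists S.
(* The basic sets disjoint from a closed section cover its complement; on the comeager set [V k] may
   replace [W k]. *)
pose U n m := [set k | W k `<=` ~` [set y | S n m (x, y)]].
exists (fun n m => ~` \bigcup_(k in U n m) V k) => [n m|y Oy].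
  by apply: open_closedC; apply: bigcup_open => k _; have [] := VO k.
have WV k : W k y <-> V k y.
  have [_ _] := VO k; apply => m.
  by have := Oy (pickle (k, m)); rewrite pickleK.
have SB n m : S n m (x, y) <-> (~` \bigcup_(k in U n m) V k) y.
  split => [Sy [k Uk /WV /Uk] // |nUy]; apply: contrapT => nSy.
  have [| // |k Wky WkS] := bW y (~` [set y | S n m (x, y)]).
    by apply: closed_openC; apply: closed_section; have [] := S_ n.
  by apply: nUy; exists k => //; apply/WV.
rewrite EF; split => [Ey n|By n _].
  have := Ey n I; have [_ ->] := S_ n.
  by move=> [m _ /SB]; exists m.
have [m /SB Sm] := By n; have [_ ->] := S_ n.
by exists m.
Qed.

(** * Generic points of the shift *)

(** Only finitely many [j] are concerned. Continuity of the translations comes from such bounds,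
    since each coordinate of the value reads one coordinate of the argument. *)
Lemma code_bound (J : Type) (e : J -> nat) (u : J -> nat) (N : nat) :
  injective e -> exists M, forall j, e j < N -> u j < M.
Proof.
move=> einj; elim: N => [|N [M uM]]; first by exists 0.
have [[j ejN]|nj] := pselect (exists j, e j = N).
  exists (maxn M (u j).+1) => j'; rewrite leq_max ltnS leq_eqVlt => /orP[/eqP ej'|/uM->//].
  by rewrite (einj j' j) ?ej'// leqnn orbT.
exists M => j; rewrite ltnS leq_eqVlt => /orP[/eqP ejN|/uM//].
by case: nj; exists j.
Qed.

Lemma code_unbounded (T : Type) (u : T -> nat) (n : nat) :
  injective u -> infinite_set [set: T] -> exists t, n <= u t.
Proof.
move=> uinj Tinf; apply: contrapT => small; apply: Tinf.
apply: (@sub_finite_set _ _ (u @^-1` `I_n)).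
  by move=> t _ /=; rewrite ltnNge; apply/negP => ?; apply: small; exists t.
by apply: finite_preimage => //; exact: in2W.
Qed.

Section Shift.
Variables (I : countType) (D : I -> groupType) (Gamma : groupType).
Hypothesis Gamma_inf : infinite_set [set: Gamma].
Let J := {i : I & (D i * Gamma)%type}.
Variables (e : J -> nat) (einj : injective e).
Implicit Types (f x y : J -> bool) (h : forall i, (D i * Gamma)%type).

Definition node i (q : D i * Gamma) : J := existT _ i q.

(** [J] is the disjoint union of the groups [D i * Gamma], so [J -> bool] is the product of their
    Bernoulli shifts, and [h] acts by left translation in each factor. *)
Definition shift h f : J -> bool :=
  fun j => f (node ((h (tag j))^-1 * tagged j)%g).

Lemma shift_mul h h' f :
  shift (fun i => h i * h' i)%g f = shift h (shift h' f).
Proof. by apply/funext => j; rewrite /shift /= invgM mulgA. Qed.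

Lemma eq_shift h h' f : (forall i, h i = h' i) -> shift h f = shift h' f.
Proof. by move=> hh'; apply/funext => j; rewrite /shift hh'. Qed.

Lemma shift1 f : shift (fun=> 1%g) f = f.
Proof. by apply/funext => -[i q]; rewrite /shift /= invg1 mul1g. Qed.

Lemma shift_code_bound h n : exists m, forall f f',
  agree e m f f' -> agree e n (shift h f) (shift h f').
Proof.
have [m mP] := code_bound (fun j => e (node ((h (tag j))^-1 * tagged j)%g)) n einj.
by exists m => f f' ff' j /mP; exact: ff'.
Qed.

(** Each pair [(q, q')] excludes at most one [c], namely [q.2 * q'.2^-1], and finitely many pairs
    have codes this small, whereas [Gamma] is infinite. *)
Lemma node_fresh i (d : D i) (a b : nat) : exists c : Gamma, forall q q',
  e (node q) < a -> e (node q') < b -> ((d, c)^-1 * q)%g <> q'.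
Proof.
have fin n : finite_set [set q : D i * Gamma | e (node q) < n].
  apply: (@finite_preimage _ _ `I_n (fun q : D i * Gamma => e (node q))) => //.
  by move=> q q' _ _ /einj /eqP; rewrite eq_Tagged => /eqP.
have finbad := finite_image (fun p => p.1.2 * (p.2.2)^-1)%g (finite_setX (fin a) (fin b)).
have [c [_ cP]] := infinite_setN0 (infinite_setD Gamma_inf finbad).
exists c => q q' qa qb E; apply: cP; exists (q, q') => //=.
by rewrite -E /=invgM invgK mulVKg.
Qed.

(** The identity is moved to a place [q] not yet decided, where the value is set opposite to that at
    [g^-1 * q]. *)
Lemma free_dense i (g : D i * Gamma) n f : g <> 1%g ->
  exists f' m, agree e n f f' /\ forall x, agree e m f' x ->
    exists q, x (node (g^-1 * q)%g) <> x (node q).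
Proof.
move=> g1; have [c cP] := node_fresh (1%g : D i) (e (node (1%g : D i * Gamma))).+1 n.
pose q : D i * Gamma := (1, c)^-1%g.
have qn : n <= e (node q).
  rewrite leqNgt; apply/negP => /(cP 1%g q (ltnSn _)); apply.
  by rewrite mulg1.
have gq : node (g^-1 * q)%g <> node q.
  move=> /eqP; rewrite eq_Tagged => /eqP /= E; apply: g1.
  have /(congr1 (fun z => z * q^-1)%g) := E.
  by rewrite mulgK mulgV => /(congr1 (fun z => z^-1)%g); rewrite invgK invg1.
exists (fun j => if pselect (j = node q) then ~~ f (node (g^-1 * q)%g) else f j).
exists (maxn (e (node (g^-1 * q)%g)) (e (node q))).+1; split => [j jn|x fx].
  by case: pselect => // jq; exfalso; move: jn; rewrite jq ltnNge qn.
exists q; rewrite -!fx ?ltnS ?leq_max ?leqnn ?orbT//.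
by do 2 case: pselect => //= ?; case: (f _).
Qed.

(** The part [d] is prescribed and only [c] is free: [d] will come from an element of [Delta] that
    stays fixed while [Gamma] moves. *)
Lemma mixing_dense i (g : D i * Gamma) (d : D i) N n f :
  exists f' m, agree e n f f' /\ forall x, agree e m f' x ->
    exists c, forall q, e (node q) < N ->
      x (node (g^-1 * q)%g) = x (node ((d, c)^-1 * q)%g).
Proof.
pose at_i (a : D i * Gamma) (j : J) := e (node (a * tagged_as (node (1%g : D i * Gamma)) j)%g).
have at_iE a q : at_i a (node q) = e (node (a * q)%g) by rewrite /at_i tagged_asE.
have [n1 n1P] := code_bound (at_i g^-1%g) N einj.
(* [n1] bounds the codes of the places [g^-1 * q] from which the pattern is read, so that copying
   does not overwrite them. *)
pose n' := maxn n n1.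
have [c cP] := node_fresh d N n'.
have [m1 m1P] := code_bound (at_i (d, c)^-1%g) N einj.
(* [f'] copies the pattern of [g f] at [i] to a place moved away by [c] from the
   coordinates already decided. *)
pose f' : J -> bool := fun j =>
  let q := ((d, c) * tagged_as (node (1%g : D i * Gamma)) j)%g in
  if (tag j == i) && (e (node q) < N) then f (node (g^-1 * q)%g) else f j.
have f'E r : f' (node r) = if e (node ((d, c) * r)%g) < N
    then f (node (g^-1 * ((d, c) * r))%g) else f (node r).
  by rewrite /f' /= eqxx tagged_asE.
have f'_old (r : D i * Gamma) : e (node r) < n' -> f' (node r) = f (node r).
  by move=> rn'; rewrite f'E; case: ifP => // /cP/(_ rn'); rewrite mulKg.
exists f', (maxn n' m1); split.
  move=> [i' r] jn; have [ii'|ii'] := eqVneq i' i; last first.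
    by rewrite /f' /= (negbTE ii').
  subst i'; rewrite [RHS]f'_old//; exact: leq_trans (leq_maxl _ _).
move=> x f'x; exists c => q qN.
have gqn' : e (node (g^-1 * q)%g) < n'.
  by rewrite leq_max -(at_iE g^-1%g) n1P ?orbT.
rewrite -!f'x; first 1 last.
- by rewrite leq_max -(at_iE (d, c)^-1%g) m1P ?orbT.
- by rewrite leq_max gqn'.
by rewrite f'_old// f'E mulVKg qN.
Qed.

(** Translation by [h] is a homeomorphism, so it pulls dense open sets back to dense open sets. *)
Lemma translate_dense h (O : set (J -> bool)) n f :
  (forall x, O x -> exists m, agree e m x `<=` O) ->
  (forall x m, exists2 y, agree e m x y & O y) ->
  exists f' m, agree e n f f' /\ forall x, agree e m f' x -> O (shift h x).
Proof.
move=> oO dO; pose h' i := (h i)^-1%g.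
have hh' y : shift h (shift h' y) = y.
  rewrite -shift_mul -[RHS]shift1; apply: eq_shift => i.
  by rewrite /h' mulgV.
have h'h y : shift h' (shift h y) = y.
  rewrite -shift_mul -[RHS]shift1; apply: eq_shift => i.
  by rewrite /h' mulVg.
have [n1 n1P] := shift_code_bound h' n.
have [y fy Oy] := dO (shift h f) n1.
have [m0 m0P] := oO y Oy; have [m mP] := shift_code_bound h m0.
exists (shift h' y), m; split => [|x /mP]; first by rewrite -(h'h f); exact: n1P fy.
by rewrite hh' => /m0P.
Qed.
End Shift.

(** Lets one Baire argument handle several countable families of dense open sets. *)
Lemma sum_code (A B : Type) (a : A -> nat) (b : B -> nat) :
  injective a -> injective b -> exists c : A + B -> nat, injective c.
Proof.
move=> ainj binj.
exists (fun s => pickle (match s with inl u => inl (a u) | inr v => inr (b v) end : nat + nat)%type).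
by move=> [u|u] [v|v] /(pcan_inj pickleK) // [] => [/ainj|/binj] ->.
Qed.

(** * Leaving the orbit by Baire category in the acting groups *)

Section Main.
Variables (I : countType) (D : I -> groupType) (Gamma Delta : groupType).
Variable phi : forall i, Delta -> D i.
Let J := {i : I & (D i * Gamma)%type}.
Let H := forall i, (D i * Gamma)%type.
Hypothesis Gamma_inf : infinite_set [set: Gamma].
Hypothesis I_inf : infinite_set [set: I].
Hypothesis D_nontrivial : forall i, exists d : D i, d <> 1%g.
Hypothesis phiM : forall i a b, phi i (a * b)%g = (phi i a * phi i b)%g.
Hypothesis phi_dense : forall (s : seq I) (d : forall i, D i),
  exists delta, forall i, i \in s -> phi i delta = d i.
Variables (e : J -> nat) (einj : injective e).
Variables (cG : Gamma -> nat) (cGinj : injective cG).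
Variables (cD : Delta -> nat) (cDinj : injective cD).
Implicit Types (f x y : J -> bool) (h : H).

(** Indexing by [nat] lets one group Gamma^omega serve every [I]; entries outside the range of
    [pickle] act trivially. *)
Definition diag (delta : Delta) (gamma : nat -> Gamma) : H :=
  fun i => (phi i delta, gamma (pickle i)).

Lemma diagM delta gamma delta' gamma' i :
  diag (delta * delta')%g (fun n => gamma n * gamma' n)%g i =
  (diag delta gamma i * diag delta' gamma' i)%g.
Proof. by rewrite /diag phiM. Qed.

Lemma diag1 i : diag 1%g (fun=> 1%g) i = 1%g.
Proof.
by congr (_, _); apply: (@mulgI _ (phi i 1%g)); rewrite -phiM !mulg1.
Qed.

Section Generic.
Variable O : nat -> set (J -> bool).
Hypothesis O_open : forall l x, O l x -> exists m, agree e m x `<=` O l.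
Hypothesis O_dense : forall l x m, exists2 y, agree e m x y & O l y.

(* The conjuncts: translates by a countable dense part of the acting group lie in
   the given comeager set; freeness; density of [Gamma]-orbits. *)
Definition generic x := [/\
  forall delta s l, O l (shift (diag delta (nth 1%g s)) x),
  forall i (g : D i * Gamma), g <> 1%g -> exists q, x (node (g^-1 * q)%g) <> x (node q) &
  forall i (g : D i * Gamma) (d : D i) N, exists c, forall q, e (node q) < N ->
      x (node (g^-1 * q)%g) = x (node ((d, c)^-1 * q)%g)].

Lemma generic_exists : exists x, generic x.
Proof.
pose c1 (k : Delta * seq Gamma * nat) := pickle (cD k.1.1, map cG k.1.2, k.2).
have c1inj : injective c1.
  by move=> [[a s] l] [[b t] m] /(pcan_inj pickleK) /= [/cDinj-> /(inj_map cGinj)-> ->].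
pose c2 (k : J * J * nat) := pickle (e k.1.1, e k.1.2, k.2).
have c2inj : injective c2.
  by move=> [[a s] l] [[b t] m] /(pcan_inj pickleK) /= [/einj-> /einj-> ->].
have [c3 c3inj] := sum_code einj c2inj.
have [c cinj] := sum_code c1inj c3inj.
(* In the last family [j] carries [g] and [j'] carries [d]. If their indices differ, [tagged_as]
   falls back on [j], which only adds further conditions that are also dense. *)
pose Q (k : Delta * seq Gamma * nat + (J + J * J * nat)) : set (J -> bool) :=
  match k with
  | inl (delta, s, l) => fun x => O l (shift (diag delta (nth 1%g s)) x)
  | inr (inl j) => fun x => tagged j <> 1%g ->
      exists q, x (node ((tagged j)^-1 * q)%g) <> x (node q)
  | inr (inr (j, j', N)) => fun x => exists c, forall q, e (node q) < N ->
      x (node ((tagged j)^-1 * q)%g) = x (node (((tagged_as j j').1, c)^-1 * q)%g)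
  end.
have [|x _ Qx] := @baire_product J _ e _ c Q 0 (fun=> false) cinj.
  move=> [[[delta s] l]|[j|[[j j'] N]]] n f _ _.
  - by apply: (translate_dense einj); [exact: O_open|exact: O_dense].
  - have [j1|j1] := pselect (tagged j = 1%g); first by exists f, 0; split => // x _ /(_ j1).
    have [f' [m [ff' fP]]] := free_dense Gamma_inf einj n f j1.
    by exists f', m; split => // x /fP + _.
  - exact: mixing_dense.
exists x; split => [delta s l|i g g1|i g d N].
- exact: (Qx (inl (delta, s, l))).
- exact: (Qx (inr (inl (node g)))).
- have := Qx (inr (inr (node g, node (d, 1%g : Gamma), N))).
  by rewrite /Q tagged_asE.
Qed.

Variable x : J -> bool.
Hypothesis gx : generic x.

(** At indices with code below [k] the two group elements are equal. At the others the entry of the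
    sequence is free, and mixing picks it so as to imitate [h i] although [phi i delta] is fixed. *)
Lemma approx_shift h delta (gamma : nat -> Gamma) k N :
  agree pickle k (diag delta gamma) h ->
  exists s, agree id k gamma (nth 1%g s) /\
    agree e N (shift h x) (shift (diag delta (nth 1%g s)) x).
Proof.
move=> dh; have [_ _ mix] := gx.
have /choice[c cP] i := mix i (h i) (phi i delta) N.
have [M MP] := code_bound (fun j : J => pickle (tag j)) N einj.
pose w n := if n < k then gamma n else if unpickle n is Some i then c i else 1%g.
have wE n : n < maxn k M -> nth 1%g (mkseq w (maxn k M)) n = w n by exact: nth_mkseq.
exists (mkseq w (maxn k M)); split.
  by move=> n nk; rewrite wE ?leq_max ?nk// /w nk.
move=> [i q] jN; have iM := MP _ jN.
rewrite /shift /diag wE ?leq_max ?iM ?orbT// /w pickleK /=.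
by case: ifP => [/dh <-//|_]; exact: cP.
Qed.

Lemma diag_dense h n : exists delta, exists s : seq Gamma,
  agree pickle n h (diag delta (nth 1%g s)).
Proof.
have [delta dP] := phi_dense (pmap unpickle (iota 0 n)) (fun i => (h i).1).
exists delta, (mkseq (fun k => if unpickle k is Some i then (h i).2 else 1%g) n).
move=> i iN; rewrite /diag nth_mkseq// pickleK dP; first by case: (h i).
by rewrite mem_pmap; apply/mapP; exists (pickle i); rewrite ?mem_iota// pickleK.
Qed.

Lemma shift_index_bound n : exists m, forall h h',
  agree pickle m h h' -> agree e n (shift h x) (shift h' x).
Proof.
have [m mP] := code_bound (fun j : J => pickle (tag j)) n einj.
by exists m => h h' hh' j /mP /hh'; rewrite /shift => ->.
Qed.

Variable B : nat -> nat -> set (J -> bool).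
Hypothesis B_closed : forall n m y, ~ B n m y -> exists k, agree e k y `<=` ~` B n m.
Hypothesis orbit_B : forall delta gamma, let y := shift (diag delta gamma) x in
  (forall l, O l y) -> forall n, exists m, B n m y.

(** For fixed [n] the sets [B n m] cover the translates by [diag delta gamma] lying in every [O l],
    so by Baire category in Gamma^omega one of them contains all such translates over some basic
    open set of [gamma]. Being closed, it contains the limits supplied by [approx_shift], which fill
    an open set of [h'']. *)
Lemma locally_in_B h n0 n : exists h' k, agree pickle n0 h h' /\
  exists m, forall h'', agree pickle k h' h'' ->
    (forall l, O l (shift h'' x)) -> B n m (shift h'' x).
Proof.
have [Ogx _ _] := gx.
have [delta [s0 hs0]] := diag_dense h n0.
have [[gamma [k [m [s0g n0k BP]]]]|nex] := pselect (exists gamma k m,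
    [/\ agree id n0 (nth 1%g s0) gamma, n0 <= k & forall gamma', agree id k gamma gamma' ->
      (forall l, O l (shift (diag delta gamma') x)) -> B n m (shift (diag delta gamma') x)]).
  exists (diag delta gamma), k; split.
    by move=> i iN; rewrite hs0// /diag s0g.
  exists m => h'' /approx_shift hh'' Oh''; apply: contrapT => /B_closed[N BN].
  have [s [gs hs]] := hh'' N.
  by apply: (BN _ hs); apply: BP => // l; exact: Ogx.
(* Otherwise the complement of every [B n m] is dense near [s0], and a generic [gamma] contradicts
   [orbit_B]. *)
pose Q (l : nat + nat) : set (nat -> Gamma) := match l with
  | inl l => fun gamma => O l (shift (diag delta gamma) x)
  | inr m => fun gamma => ~ B n m (shift (diag delta gamma) x) end.
have near gamma N : exists m, forall gamma', agree id m gamma gamma' ->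
    agree e N (shift (diag delta gamma) x) (shift (diag delta gamma') x).
  have [m mP] := shift_index_bound N; exists m => gamma' gg'; apply: mP => i im.
  by rewrite /diag gg'.
have [c cinj] := sum_code (@inj_id nat) (@inj_id nat).
have [|gamma _ Qg] := @baire_product nat (fun=> Gamma) id _ c Q n0 (nth 1%g s0) cinj; last first.
  have [l|m Bm] := orbit_B (delta := delta) (gamma := gamma) _ n; first exact: (Qg (inl l)).
  by have := Qg (inr m) Bm.
move=> [l|m] k gamma n0k s0g.
  (* Truncating [gamma] gives an eventually trivial sequence, to which genericity of [x] applies. *)
  have gE : agree id k gamma (nth 1%g (mkseq gamma k)).
    by move=> i ik; rewrite nth_mkseq.
  have [N NO] := O_open (Ogx delta (mkseq gamma k) l).
  have [m mP] := near (nth 1%g (mkseq gamma k)) N.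
  by exists (nth 1%g (mkseq gamma k)), m; split => // gamma' /mP /NO.
have [gamma' [gg' nB]] : exists gamma', agree id k gamma gamma' /\
    ~ B n m (shift (diag delta gamma') x).
  apply: contrapT => nex'; apply: nex; exists gamma, k, m; split => // gamma' gg' _.
  by apply: contrapT => nB; apply: nex'; exists gamma'.
have [N NB] := B_closed nB; have [r rP] := near gamma' N.
by exists gamma', r; split => // gamma'' /rP /NB.
Qed.

(** Baire category in [H]. As [Delta] is countable, generic first components of [h] already differ
    from the image of every [delta], whatever [gamma] is. *)
Lemma escape : exists h, [/\ forall l, O l (shift h x),
  forall n, exists m, B n m (shift h x) &
  forall delta gamma, shift (diag delta gamma) x <> shift h x].
Proof.
have [Ogx free _] := gx.
pose Q (l : nat + (nat + Delta)) : set H := match l with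
  | inl l => fun h => O l (shift h x)
  | inr (inl n) => fun h => (forall l, O l (shift h x)) -> exists m, B n m (shift h x)
  | inr (inr delta) => fun h => exists i, phi i delta <> (h i).1 end.
have [c' c'inj] := sum_code (@inj_id nat) cDinj.
have [c cinj] := sum_code (@inj_id nat) c'inj.
have [|h _ Qh] := @baire_product I _ pickle _ c Q 0 (fun=> 1%g) cinj.
  move=> [l|[n|delta]] n0 h _ _.
  - have [delta [s hs]] := diag_dense h n0.
    have [N NO] := O_open (Ogx delta s l); have [m mP] := shift_index_bound N.
    by exists (diag delta (nth 1%g s)), m; split => // h' /mP /NO.
  - have [h' [k [hh' [m mP]]]] := locally_in_B h n0 n.
    by exists h', k; split => // h'' /mP Bh'' Oh''; exists m; exact: Bh''.
  (* At an index beyond those decided, the first component can be moved off [phi i delta] by a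
     nontrivial [d]. *)
  - have [i in0] := code_unbounded n0 (pcan_inj (@pickleK I)) I_inf.
    have [d d1] := D_nontrivial i.
    pose h' : H := @eqtype.dfwith I (fun i => D i * Gamma)%type h i ((phi i delta * d)%g, 1%g).
    exists h', (pickle i).+1; split.
      move=> j jn; rewrite /h' dfwith_out//; apply/eqP => ij.
      by move: jn; rewrite -ij ltnNge in0.
    move=> h'' /(_ i (ltnSn _)); rewrite /h' dfwith_in => hi.
    exists i; rewrite -hi => /= E; apply: d1; apply: (@mulgI _ (phi i delta)).
    by rewrite -E mulg1.
have Oh l : O l (shift h x) by exact: (Qh (inl l)).
exists h; split => // [n|delta gamma E]; first exact: (Qh (inr (inl n))).
have [i] := Qh (inr (inr delta)); apply.
have [di|di] := pselect (diag delta gamma i = h i); first by rewrite -di.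
(* Freeness for the quotient of the two group elements gives [q]; the translates then differ at
   [diag delta gamma i * q]. *)
have [|q] := free i ((diag delta gamma i)^-1 * h i)%g.
  by move=> /(congr1 (fun z => diag delta gamma i * z)%g); rewrite mulVKg mulg1 => /esym/di.
rewrite invgM invgK; case.
have := congr1 (fun f => f (node (diag delta gamma i * q)%g)) E.
by rewrite /shift /= mulKg mulgA.
Qed.

End Generic.
End Main.

(** * The action and its instances *)

Section DiagonalAction.
Variables (R : realType) (I : countType) (D : I -> groupType) (Gamma Delta : groupType).
Variable phi : forall i, Delta -> D i.
Let J := {i : I & (D i * Gamma)%type}.
Variables (e : J -> nat) (einj : injective e).
Hypothesis phiM : forall i a b, phi i (a * b)%g = (phi i a * phi i b)%g.
Let G : topologicalGroupType :=
  (discrete_topology Delta * direct_product (fun _ : nat => discrete_topology Gamma))%type.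
Let X : topologicalType := cantor R einj.

Definition diag_action (g : G) (x : X) : X := shift (diag phi g.1 g.2) x.

Lemma diag_action_continuous : continuous_action diag_action.
Proof.
split.
  split => [x|g h x].
    by rewrite -[RHS](@shift1 _ D Gamma); apply: eq_shift => i; exact: diag1.
  by rewrite /diag_action -shift_mul; apply: eq_shift => i; exact: diagM.
move=> z A /cantor_nbhsP[n nA].
suff: \forall z' \near z, agree e n (diag_action z.1 z.2) (diag_action z'.1 z'.2).
  by apply: filterS => z' /nA.
(* One coordinate at a time: at most one has code [n]. *)
elim: n {nA} => [|n IH]; first exact: filterE.
have [[j ejn]|nj] := pselect (exists j, e j = n); last first.
  apply: filterS IH => z' zz' j; rewrite ltnS leq_eqVlt => /orP[/eqP ejn|/zz'//].
  by case: nj; exists j.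
case: j ejn => i q ejn.
(* The value at [node q] reads the argument at [r], so it is settled by [delta], one entry of
   [gamma] and that coordinate. *)
pose r : J := node ((diag phi z.1.1 z.1.2 i)^-1 * q)%g.
have near1 : \forall z' \near z, z'.1.1 = z.1.1.
  have : (fun z' : G * X => z'.1.1) @ z --> z.1.1.
    by apply: cvg_comp; [exact: cvg_fst|exact: cvg_fst].
  exact: (fun h => h [set z.1.1] (@discrete_set1 (discrete_topology Delta) _)).
have near2 : \forall z' \near z, z'.1.2 (pickle i) = z.1.2 (pickle i).
  have : (fun z' : G * X => z'.1.2 (pickle i)) @ z --> z.1.2 (pickle i).
    apply: (cvg_comp (fun z' : G * X => z'.1.2)
      (fun g : direct_product (fun _ : nat => discrete_topology Gamma) => g (pickle i))).
      by apply: cvg_comp; [exact: cvg_fst|exact: cvg_snd].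
    exact: direct_product_eval_continuous.
  exact: (fun h => h [set _] (@discrete_set1 (discrete_topology Gamma) _)).
have near3 : \forall z' \near z, agree e (e r).+1 z.2 z'.2.
  have : (fun z' : G * X => z'.2) @ z --> z.2 by exact: cvg_snd.
  move=> h; apply: (h (agree e (e r).+1 z.2)).
  by apply/cantor_nbhsP; exists (e r).+1.
apply: filterS (filterI IH (filterI near1 (filterI near2 near3))).
move=> z' [zz' [z1 [z2 z3]]] j; rewrite ltnS leq_eqVlt => /orP[/eqP ejn'|/zz'//].
have -> : j = node q by apply: einj; rewrite ejn' -ejn.
rewrite /diag_action /shift /= /diag z1 z2.
by rewrite -z3.
Qed.

Hypothesis Gamma_inf : infinite_set [set: Gamma].
Hypothesis I_inf : infinite_set [set: I].
Hypothesis D_nontrivial : forall i, exists d : D i, d <> 1%g.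
Hypothesis phi_dense : forall (s : seq I) (d : forall i, D i),
  exists delta, forall i, i \in s -> phi i delta = d i.
Variables (cG : Gamma -> nat) (cGinj : injective cG).
Variables (cD : Delta -> nat) (cDinj : injective cD).

Lemma diag_action_not_potentially_Pi03 : ~ potentially_Pi03 R (orbit_rel diag_action).
Proof.
move=> /potentially_Pi03_section[Q odQ EB].
have Q_open l (x : X) : Q l x -> exists m, agree e m x `<=` Q l.
  by move: x; apply/cantor_openP; have [] := odQ l.
have Q_dense l (x : X) m : exists2 y, agree e m x y & Q l y.
  by move: x m; apply/cantor_denseP; have [] := odQ l.
have [x gx] := generic_exists phi Gamma_inf einj cGinj cDinj Q_open Q_dense.
have [B cB BE] := EB x.
have B_open n m (y : X) : ~ B n m y -> exists k, agree e k y `<=` ~` B n m.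
  by move: y; apply/cantor_openP; apply: closed_openC.
have orbit_B delta gamma : let y := shift (diag phi delta gamma) x in
    (forall l, Q l y) -> forall n, exists m, B n m y.
  by move=> y Oy; apply/(BE y Oy); exists (delta, gamma).
have [h [Oh Bh nh]] :=
  escape I_inf D_nontrivial phi_dense einj cDinj Q_open gx B_open orbit_B.
by have [[delta gamma] /nh] : orbit_rel diag_action (x, shift h x) by apply/BE.
Qed.

End DiagonalAction.

(** * Countable groups with dense image, and the three families *)

Lemma countable_code (T : Type) : countable [set: T] -> exists c : T -> nat, injective c.
Proof.
by move=> /countable_injP[c cinj]; exists c => u v; apply: cinj; rewrite inE.
Qed.

Lemma dense_product_non_potentially_Pi03 (R : realType) (I : countType)
    (D : I -> groupType) (Gamma Delta : groupType) (phi : forall i, Delta -> D i) :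
  infinite_set [set: I] -> countable [set: Gamma] -> infinite_set [set: Gamma] ->
  countable [set: Delta] -> (forall i, countable [set: D i]) ->
  (forall i, exists d : D i, d <> 1%g) ->
  (forall i a b, phi i (a * b)%g = (phi i a * phi i b)%g) ->
  (forall (s : seq I) (d : forall i, D i),
    exists delta, forall i, i \in s -> phi i delta = d i) ->
  has_non_potentially_Pi03_action R
    (discrete_topology Delta * direct_product (fun _ : nat => discrete_topology Gamma))%type.
Proof.
move=> I_inf /countable_code[cG cGinj] Gamma_inf /countable_code[cDelta cDinj] cD.
move=> Dn1 phiM phi_dense.
have [c cinj] : exists c : forall i, D i -> nat, forall i, injective (c i).
  by have /all_sig[c cP] := fun i => cid (countable_code (cD i)); exists c.
pose e (j : {i : I & (D i * Gamma)%type}) :=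
  pickle (pickle (tag j), c _ (tagged j).1, cG (tagged j).2).
have einj : injective e.
  move=> [i [d g]] [i' [d' g']] /(pcan_inj pickleK) /= [/(pcan_inj pickleK) ii'].
  by subst i' => /cinj-> /cGinj->.
exists (cantor R einj); first exact: polish_cantor.
exists (@diag_action R I D Gamma Delta phi e einj); first exact: diag_action_continuous.
exact: diag_action_not_potentially_Pi03 cGinj _ cDinj.
Qed.

Lemma countable_direct_sum (I : countType) (D : I -> groupType) :
  (forall i, countable [set: D i]) -> countable [set: direct_sum D].
Proof.
move=> cD; have /all_sig[c cP] := fun i => cid (countable_code (cD i)).
have /choice[s sP] (f : direct_sum D) : exists s : seq I, forall i, val f i <> 1%g -> i \in s.
  have /asboolP/finite_seqP[s fs] := valP f.
  by exists s => i fi; have : [set i | val f i <> 1%g] i by []; rewrite fs.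
pose L f := [seq (pickle i, c i (val f i)) | i <- s f].
(* This treats only the support of [f]; used in both directions it covers every index. *)
have LP f g i : L f = L g -> val f i <> 1%g -> val f i = val g i.
  move=> fg /sP /(map_f (fun i => (pickle i, c i (val f i)))).
  rewrite -/(L f) fg => /mapP[i' _ [/(pcan_inj pickleK) ii']].
  by subst i' => /cP.
apply/countable_injP; exists (fun f => pickle (L f)) => f g _ _ /(pcan_inj pickleK) fg.
apply: val_inj; apply: functional_extensionality_dep => i.
have [fi|/(LP f g)->//] := pselect (val f i = 1%g).
have [gi|/(LP g f)->//] := pselect (val g i = 1%g).
by rewrite fi gi.
Qed.

Lemma direct_sum_non_potentially_Pi03 (R : realType) (I : countType)
    (D : I -> groupType) (Gamma : groupType) :
  infinite_set [set: I] -> countable [set: Gamma] -> infinite_set [set: Gamma] ->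
  (forall i, countable [set: D i]) -> (forall i, exists d : D i, d <> 1%g) ->
  has_non_potentially_Pi03_action R
    (discrete_topology (direct_sum D) *
     direct_product (fun _ : nat => discrete_topology Gamma))%type.
Proof.
move=> I_inf cG G_inf cD Dn1.
apply: (@dense_product_non_potentially_Pi03 R I D Gamma (direct_sum D) (fun i f => val f i)) => //.
  exact: countable_direct_sum.
(* Density prescribes finitely many coordinates at a time, which a finitely supported element
   realizes. *)
move=> s d; pose f : direct_product D := fun i => if i \in s then d i else 1%g.
have fP : f \in @finitely_supported I D.
  apply/asboolP; apply: sub_finite_set (finite_seq s) => i /=.
  by rewrite /f; case: ifP.
by exists (Sub f fP) => i si; rewrite SubK /f si.
Qed.

Lemma infinite_primes : infinite_set [set: {p : nat | prime p}].
Proof.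
move=> /finite_seqP[s sT].
have [p sp pp] := prime_above (\max_(q <- s) val q).
have : [set` s] (Sub p pp) by rewrite -sT.
move=> /= /(@leq_bigmax_seq _ _ xpredT (fun q : {p : nat | prime p} => val q)) /(_ isT).
by rewrite leqNgt sp.
Qed.

(** Density of the integers in the product of the cyclic groups of prime order: each new prime is
    coprime to the product [M] of those already treated. *)
Lemma chinese_primes (s : seq {p : nat | prime p})
    (d : forall p : {p : nat | prime p}, 'Z_(val p)) :
  exists z : nat, forall p, p \in s -> (z%:R)%R = d p.
Proof.
elim: s => [|p s [z zs]]; first by exists 0.
have [ps|ps] := boolP (p \in s).
  by exists z => q; rewrite inE => /predU1P[->|]; exact: zs.
pose M := \prod_(q <- s) val q.
have cM : coprime M (val p).
  rewrite /M; elim: s ps {zs M} => [|q s IH]; first by rewrite big_nil coprime1n.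
  rewrite inE negb_or big_cons coprimeMl => /andP[pq /IH->]; rewrite andbT.
  rewrite prime_coprime ?(valP q)// dvdn_prime2 ?(valP q) ?(valP p)//.
  by rewrite eq_sym.
exists (chinese M (val p) z (d p)) => q; rewrite inE => /predU1P[->|qs].
  apply: ord_inj; rewrite val_Zp_nat ?prime_gt1 ?(valP p)// chinese_modr//.
  by rewrite modn_small// -[ltnRHS]Zp_cast ?prime_gt1 ?(valP p).
rewrite -(zs q)//; apply: ord_inj; rewrite !val_Zp_nat ?prime_gt1 ?(valP q)//.
have qM : val q %| M by rewrite /M (big_rem q)//= dvdn_mulr.
by rewrite -(modn_dvdm _ qM) chinese_modl// modn_dvdm.
Qed.

Lemma Zp_mult_nontrivial (p : nat) :
  exists d : Algebra.to_multiplicative 'Z_p, d <> 1%g.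
Proof. by exists (1%R : 'Z_p) => /eqP; rewrite (oner_eq0 'Z_p). Qed.

Lemma Zp_mult_countable (p : nat) : countable [set: Algebra.to_multiplicative 'Z_p].
Proof. exact: (@countableP ('Z_p : countType)). Qed.

Theorem theorem5p1 (R : realType) (Gamma : groupType)
    (countable_Gamma : countable [set: Gamma]%classic)
    (infinite_Gamma : infinite_set [set: Gamma]%classic) :
  [/\ forall p : nat, prime p ->
        has_non_potentially_Pi03_action R
          (discrete_topology
             (direct_sum (fun _ : nat => Algebra.to_multiplicative 'Z_p))
           * direct_product (fun _ : nat => discrete_topology Gamma))%type,
      has_non_potentially_Pi03_action R
        (discrete_topology
           (direct_sum (fun p : {p : nat | prime p} =>
              Algebra.to_multiplicative 'Z_(val p)))
         * direct_product (fun _ : nat => discrete_topology Gamma))%type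
    & has_non_potentially_Pi03_action R
        (discrete_topology (Algebra.to_multiplicative int)
         * direct_product (fun _ : nat => discrete_topology Gamma))%type].
Proof.
split.
- move=> p _; apply: direct_sum_non_potentially_Pi03 => // [|i|i].
  + exact: infinite_nat.
  + exact: Zp_mult_countable.
  + exact: Zp_mult_nontrivial.
- apply: direct_sum_non_potentially_Pi03 => // [|i|i].
  + exact: infinite_primes.
  + exact: Zp_mult_countable.
  + exact: Zp_mult_nontrivial.
(* The integers act through their residues modulo all primes. *)
- apply: (@dense_product_non_potentially_Pi03 R {p : nat | prime p}
    (fun p => Algebra.to_multiplicative 'Z_(val p)) Gamma
    (Algebra.to_multiplicative int) (fun p z => ((z : int)%:~R : 'Z_(val p))%R)) => //.
  + exact: infinite_primes.
  + exact: (@countableP (int : countType)).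
  + by move=> i; exact: Zp_mult_countable.
  + by move=> i; exact: Zp_mult_nontrivial.
  + by move=> p a b; exact: intrD.
  + by move=> s d; have [z zP] := chinese_primes s d; exists (Posz z) => p /zP.
Qed.
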